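(* Let $W$ and $Z$ be standard normal random variables, $U$ uniform on $(0,1)$, and $R$ Rayleigh distributed with density $re^{-r^2/2}$, $r>0$. If all of these variables are independent, then $$\frac{W^2+(1-U)^2R^2}{1+U^2R^2/Z^2}\ \stackrel{d}{=}\ Z^2.$$ *)

(* Defs.v *)
From HB Require Import structures.
From mathcomp Require Import all_boot all_order all_algebra finmap.
From mathcomp Require Import all_classical all_reals all_analysis.

Set Implicit Arguments.
Unset Strict Implicit.
Unset Printing Implicit Defensive.
Import Order.TTheory GRing.Theory Num.Theory.
Import numFieldNormedType.Exports.

Local Open Scope classical_set_scope.
Local Open Scope ring_scope.

(* Laws are compared on measurable sets only: [distribution P X] and
   [mu] are functions on all of [set T'], and their values on non-measurable
   sets carry no meaning. *)
Definition has_law d d' (T : measurableType d) (T' : measurableType d')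
    (R : realType) (P : probability T R) (X : {RV P >-> T'})
    (mu : set T' -> \bar R) : Prop :=
  forall A : set T', measurable A -> distribution P X A = mu A.

(* Stated for plain functions, so that it applies directly to pointwise
   expressions in random variables; [pushforward P X] is a law only when [X] is
   measurable, hence the first two clauses. *)
Definition eq_in_law d d' (T : measurableType d) (T' : measurableType d')
    (R : realType) (P : probability T R) (X Y : T -> T') : Prop :=
  [/\ measurable_fun [set: T] X, measurable_fun [set: T] Y &
      forall A : set T', measurable A -> pushforward P X A = pushforward P Y A].

(* The sets [A i] with [i] outside of [J] are irrelevant. *)
Definition mutually_independent d d' (T : measurableType d)
    (T' : measurableType d') (R : realType) (P : probability T R)
    (I : choiceType) (X : I -> {RV P >-> T'}) : Prop :=
  forall (J : {fset I}) (A : I -> set T'),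
    (forall i, i \in J -> measurable (A i)) ->
    P (\bigcap_(i in [set` J]) X i @^-1` A i) =
    (\prod_(i <- J) P (X i @^-1` A i))%E.

Definition rayleigh_pdf (R : realType) (r : R) : R :=
  if 0 < r then r * expR (- r ^+ 2 / 2) else 0.

Definition rayleigh_prob (R : realType) (A : set R) : \bar R :=
  (\int[lebesgue_measure]_(r in A) (rayleigh_pdf r)%:E)%E.

(* Main.v *)
(** Put [p = U R] and [q = (1 - U) R]. The pair [(p, q)] has density
    [exp (- (p + q)^2 / 2)] on the quadrant [p, q >= 0], and the left-hand side
    is [Z^2 (W^2 + q^2) / (Z^2 + p^2)]. Use the slopes [t = q / |W|] and
    [v = p / |Z|], and rescale by [W = x / sqrt (1 + t^2)] and
    [Z = y / sqrt (1 + v^2)]: the joint density becomes proportional to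
    [|x y| / ((1 + t^2) (1 + v^2))
       exp (- (x^2 + y^2 + 2 |x y| t v / sqrt ((1 + t^2) (1 + v^2))) / 2)],
    which is symmetric in [t] and [v], while the left-hand side becomes
    [x^2 / (1 + v^2)] and [W^2] becomes [x^2 / (1 + t^2)]. Exchanging [t] and
    [v] shows that they have the same law, and [W^2] has the law of [Z^2]. *)
Require Import Defs.
From HB Require Import structures.
From mathcomp Require Import all_boot all_order all_algebra finmap.
From mathcomp Require Import all_classical all_reals all_analysis.
From mathcomp Require Import measurable_realfun ring lra.
Import Order.TTheory GRing.Theory Num.Theory.
Import numFieldNormedType.Exports.

Local Open Scope classical_set_scope.
Local Open Scope ring_scope.

(** * Affine change of variable for Lebesgue measure on the line *)

Section LebesgueChangeOfVariable.
Context {K : realType}.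
Notation mu := (@lebesgue_measure K).
Local Open Scope ereal_scope.

(* [lebesgue_measure] lives on [measurableTypeR K], whose display is not the
   default one of [K], although the measurable sets are convertible. *)
Notation M := (measurableTypeR K).

Lemma measurable_affine (c b : K) :
  measurable_fun [set: M] ((fun x => c * x + b)%R : M -> M).
Proof. by apply: measurable_funD => //; exact: measurable_funM. Qed.

(** The image of Lebesgue measure under [x |-> c x + b], multiplied by [c], gives every half-open
    interval its length, so by uniqueness it is Lebesgue measure again. *)
Lemma ge0_integral_affine (c b : K) (f : M -> \bar K) : (0 < c)%R ->
  measurable_fun [set: M] f -> (forall x, 0 <= f x) ->
  \int[mu]_x f x = c%:E * \int[mu]_x f (c * x + b)%R.
Proof.
move=> c0 mf f0.
pose phi : M -> M := (fun x => c * x + b)%R.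
have mphi : measurable_fun [set: M] phi by exact: measurable_affine.
pose e : {nonneg K} := NngNum (ltW c0).
(* The existential makes [nu] an abstract measure known only through its values; the same device
   serves for the image measures below. *)
have [nu nuE] : exists nu : {measure set M -> \bar K},
    nu = mscale e (pushforward mu phi) :> (set M -> \bar K).
  by unshelve eexists; first exact: (mscale e (pushforward mu phi)).
transitivity (\int[nu]_x f x).
  apply: eq_measure_integral => A mA _.
  apply: lebesgue_measure_unique => //= _ [[x1 x2]] _ <-.
  rewrite nuE /mscale /= /pushforward.
  have -> : phi @^-1` `]x1, x2] = `](x1 - b) / c, (x2 - b) / c]%classic%R.
    apply/seteqP; split => x; rewrite /phi /= !in_itv /= ltr_pdivrMr//;
      by rewrite ler_pdivlMr// ltrBlDr lerBrDr [(x * c)%R]mulrC.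
  rewrite !lebesgue_measure_itv /= !lte_fin ltr_pM2r ?invr_gt0//.
  rewrite ltrD2r; case: ifPn => _; last by rewrite mule0.
  rewrite -!EFinB -EFinM; congr EFin; field; lra.
rewrite nuE ge0_integral_mscale//; congr (_ * _).
by rewrite ge0_integral_pushforward.
Qed.

End LebesgueChangeOfVariable.

(** * Integration against a measure with a density *)

Section Density.
Context {d} {T : measurableType d} {K : realType}.
Context (mu : {sigma_finite_measure set T -> \bar K}).
Context (nu : {finite_measure set T -> \bar K}).
Local Open Scope ereal_scope.

(** Having a density forces [nu] to be absolutely continuous. Its Radon-Nikodym derivative and [g]
    have the same integral over every measurable set, hence agree almost everywhere, and the change
    of variables known for the derivative transfers to [g]. *)
Lemma ge0_integral_density (g : T -> K) (f : T -> \bar K) :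
  measurable_fun setT g -> (forall x, 0 <= g x)%R ->
  (forall A, measurable A -> nu A = \int[mu]_(x in A) (g x)%:E) ->
  measurable_fun setT f -> (forall x, 0 <= f x) ->
  \int[nu]_x f x = \int[mu]_x ((g x)%:E * f x).
Proof.
move=> mg g0 nuE mf f0.
have numu : nu `<< mu.
  apply/null_content_dominatesP => A mA A0; rewrite nuE//.
  by rewrite null_set_integral//; exact/measurable_funTS/measurable_EFinP.
rewrite -(Radon_Nikodym_SigmaFinite.change_of_variables numu f0)//.
have mRN := measurable_int _ (Radon_Nikodym_SigmaFinite.f_integrable numu).
under [RHS]eq_integral do rewrite muleC.
apply: ae_eq_integral => //.
- exact: emeasurable_funM.
- by apply: emeasurable_funM => //; exact/measurable_EFinP.
apply: ae_eqe_mul2l; apply: integral_ae_eq => //.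
- exact: Radon_Nikodym_SigmaFinite.f_integrable.
- exact/measurable_EFinP.
- by move=> E _ mE; rewrite -nuE// -Radon_Nikodym_SigmaFinite.f_integral.
Qed.

End Density.

(** * From factorization on rectangles to product measures *)

Section JointLaw.
Context {d d1 d2} {T : measurableType d} {T1 : measurableType d1}
  {T2 : measurableType d2} {K : realType}.
Context (P : probability T K) (m1 : probability T1 K) (m2 : probability T2 K).
Local Open Scope ereal_scope.

(** As functions of [C], both sides are finite measures that agree on rectangles, a generating class
    stable under intersection. The extra event [E] allows one pair of variables to be treated while
    another stays fixed. Scaling by [P E], instead of conditioning on [E], covers the case
    [P E = 0]. *)
Lemma joint_law (E : set T) (X : T -> T1) (Y : T -> T2) :
  measurable E -> measurable_fun setT X -> measurable_fun setT Y ->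
  (forall A B, measurable A -> measurable B ->
    P (E `&` (X @^-1` A `&` Y @^-1` B)) = P E * (m1 A * m2 B)) ->
  forall C, measurable C ->
    P (E `&` (fun t => (X t, Y t)) @^-1` C) = P E * (m1 \x m2) C.
Proof.
move=> mE mX mY H.
have mXY : measurable_fun setT (fun t => (X t, Y t)).
  exact: measurable_fun_pair.
have PE : P E \is a fin_num by exact: fin_num_measure.
pose e : {nonneg K} := NngNum (fine_ge0 (measure_ge0 P E)).
pose XY t := (X t, Y t).
have [l lE] : exists l : {measure set (T1 * T2) -> \bar K},
    l = pushforward (mrestr P mE) XY :> (set _ -> \bar K).
  by unshelve eexists; first exact: (pushforward (mrestr P mE) XY).
have [r rE] : exists r : {measure set (T1 * T2) -> \bar K},
    r = mscale e (m1 \x m2)%E :> (set _ -> \bar K).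
  by unshelve eexists; first exact: (mscale e (m1 \x m2)%E).
pose G : set (set (T1 * T2)) :=
  [set C | exists A, measurable A /\ exists B, measurable B /\ C = A `*` B].
have lr C : measurable C -> l C = r C.
  apply: (measure_unique G (fun=> setT)).
  - rewrite measurable_prod_measurableType //; congr (<<s _ >>).
    rewrite predeqE; split => [[A mA [B mB <-]]|[A [mA [B [mB ->]]]]].
      by exists A; split => //; exists B.
    by exists A => //; exists B.
  - move=> /= _ _ [X1 [mX1 [X2 [mX2 ->]]]] [Y1 [mY1 [Y2 [mY2 ->]]]].
    rewrite -setXI; exists (X1 `&` Y1); split; first exact: measurableI.
    by exists (X2 `&` Y2); split => //; exact: measurableI.
  - move=> _; exists setT; split => //; exists setT; split => //.
    by rewrite setXTT.
  - exact: bigcup_const.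
  - move=> _ [A [mA [B [mB ->]]]].
    rewrite lE rE /pushforward /mrestr /mscale/=.
    by rewrite product_measure1E// fineK// -H// setIC.
  - move=> _; rewrite lE /pushforward /mrestr /=.
    by rewrite preimage_setT setTI ltey_eq PE.
move=> C mC; have := lr C mC.
by rewrite lE rE /pushforward /mrestr /mscale /= fineK// setIC.
Qed.

End JointLaw.

(** * Measurability of the real operations that occur in the integrands *)

Section MeasurableReal.
Context {d} {T : measurableType d} {K : realType}.

Lemma measurable_invr (f : T -> K) :
  measurable_fun setT f -> measurable_fun setT (fun t => (f t)^-1).
Proof.
move=> mf.
(* Squaring makes the base nonnegative, so a power function with constant exponent can replace
   inversion; where [f] vanishes, both sides are 0 by the convention [0^-1 = 0]. *)
have -> : (fun t => (f t)^-1) = (fun t => f t * (f t ^+ 2) `^ (-1)).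
  apply/funext => t; have [->|f0] := eqVneq (f t) 0.
    by rewrite invr0 mul0r.
  by rewrite powR_inv1 ?sqr_ge0// expr2 invfM mulrA divff// mul1r.
apply: measurable_funM => //.
exact: (measurableT_comp (measurable_powR (-1)) (measurable_funX 2 mf)).
Qed.

Lemma measurable_sqrtr (f : T -> K) :
  measurable_fun setT f -> measurable_fun setT (fun t => Num.sqrt (f t)).
Proof.
move=> mf; apply: (measurableT_comp _ mf).
by apply: continuous_measurable_fun => x; exact: sqrt_continuous.
Qed.

Lemma measurable_normr (f : T -> K) :
  measurable_fun setT f -> measurable_fun setT (fun t => `|f t|).
Proof. by move=> mf; exact: measurableT_comp. Qed.

Lemma measurable_oppr (f : T -> K) :
  measurable_fun setT f -> measurable_fun setT (fun t => - f t).
Proof. by move=> mf; exact: measurableT_comp. Qed.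

Lemma measurable_expR_comp (f : T -> K) :
  measurable_fun setT f -> measurable_fun setT (fun t => expR (f t)).
Proof. by move=> mf; exact: measurableT_comp. Qed.

Lemma measurable_ler_nat (f g : T -> K) :
  measurable_fun setT f -> measurable_fun setT g ->
  measurable_fun setT (fun t => (f t <= g t)%R%:R : K).
Proof.
move=> mf mg.
have -> : (fun t => (f t <= g t)%R%:R) =
    (fun t => if f t <= g t then 1 else 0 : K).
  by apply/funext => t; case: ifP.
by apply: measurable_fun_ifT => //; exact: measurable_fun_ler.
Qed.

End MeasurableReal.

Ltac measurability :=
  repeat match goal with
  | |- measurable_fun _ (fun _ => ?c) => exact: measurable_cst
  | |- measurable_fun _ (fun t => t) => exact: measurable_id
  | |- measurable_fun _ (cst _) => exact: measurable_cst
  | |- measurable_fun _ id => exact: measurable_id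
  | |- measurable_fun _ fst => exact: measurable_fst
  | |- measurable_fun _ snd => exact: measurable_snd
  | H : measurable_fun _ ?f |- measurable_fun _ (fun t => ?f (fst t)) =>
      exact: (measurableT_comp H measurable_fst)
  | |- measurable_fun _ (fun t => fst t) => exact: measurable_fst
  | |- measurable_fun _ (fun t => snd t) => exact: measurable_snd
  | |- measurable_fun _ (fun t => fst (@?f t)) =>
      apply: (measurableT_comp measurable_fst)
  | |- measurable_fun _ (fun t => snd (@?f t)) =>
      apply: (measurableT_comp measurable_snd)
  | |- measurable_fun _ (fun t => (_ ^+ _)%R) => apply: measurable_funX
  | |- measurable_fun _ (fun t => (_ - _)%R) => apply: measurable_funB
  | |- measurable_fun _ (fun t => (_ + _)%R) => apply: measurable_funD
  | |- measurable_fun _ (fun t => (_ * _)%R) => apply: measurable_funM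
  | |- measurable_fun _ (fun t => (- _)%R) =>
      apply: measurable_oppr
  | |- measurable_fun _ (fun t => (_^-1)%R) => apply: measurable_invr
  | |- measurable_fun _ (fun t => Num.sqrt _) => apply: measurable_sqrtr
  | |- measurable_fun _ (fun t => (`|_|)%R) =>
      apply: measurable_normr
  | |- measurable_fun _ (fun t => expR _) =>
      apply: measurable_expR_comp
  | |- measurable_fun _ (fun t => (_ %:R)%R) => apply: measurable_ler_nat
  | |- measurable_fun _ (fun t => (_, _)) => apply: measurable_fun_pair
  | _ => assumption
  end.

(** * Tonelli and the slope substitution in the plane *)

Section Plane.
Context {K : realType}.
Notation mu := (@lebesgue_measure K).
Notation M := (measurableTypeR K).
Local Open Scope ereal_scope.

(** A point is Lebesgue null. This discards the fibres [w = 0] and [r = 0], where the substitutions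
    [q = |w| t] and [p = u r] degenerate. *)
Lemma eq_integral_off0 (f g : M -> \bar K) :
  measurable_fun setT f -> measurable_fun setT g ->
  (forall x : K, x != 0%R -> f x = g x) ->
  \int[mu]_x f x = \int[mu]_x g x.
Proof.
move=> mf mg fg.
rewrite -(@integral_setD1 K f 0%R setT)//; last 2 first.
- exact: measurableD.
- exact: measurable_funTS.
rewrite -(@integral_setD1 K g 0%R setT)//; last 2 first.
- exact: measurableD.
- exact: measurable_funTS.
by apply: eq_integral => x; rewrite inE => -[_ /= /eqP]; exact: fg.
Qed.

Lemma measurable_comp2 {h : M -> M -> \bar K} {d} {T : measurableType d}
    (f1 f2 : T -> K) :
  measurable_fun setT (fun v : M * M => h v.1 v.2) ->
  measurable_fun setT f1 -> measurable_fun setT f2 ->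
  measurable_fun setT (fun t => h (f1 t) (f2 t)).
Proof.
move=> mh m1 m2.
exact: (measurableT_comp mh (measurable_fun_pair (T1 := M) (T2 := M) m1 m2)).
Qed.

Lemma measurable_integral {d} {T : measurableType d} (h : T -> M -> \bar K) :
  measurable_fun setT (fun v : T * M => h v.1 v.2) ->
  (forall t x, 0 <= h t x) ->
  measurable_fun setT (fun t => \int[mu]_x h t x).
Proof.
move=> mh h0.
exact: (measurable_fun_fubini_tonelli_F (m2 := mu)
  (fun v : T * M => h v.1 v.2)).
Qed.

Lemma swap_integral {h : M -> M -> \bar K} :
  measurable_fun setT (fun v : M * M => h v.1 v.2) ->
  (forall t x, 0 <= h t x) ->
  \int[mu]_x \int[mu]_y h x y = \int[mu]_y \int[mu]_x h x y.
Proof.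
move=> mh h0.
exact: (fubini_tonelli (m1 := mu) (m2 := mu) (fun v : M * M => h v.1 v.2)).
Qed.

(** Two one-dimensional substitutions separated by an exchange of integrals: [q = |w| t] at fixed
    [w], with Jacobian [|w|], then [w = x / sqrt (1 + t^2)] at fixed [t]. In the new coordinates
    [w^2 + q^2 = x^2]. *)
Lemma slope_substitution (h : M -> M -> \bar K) :
  measurable_fun setT (fun v : M * M => h v.1 v.2) ->
  (forall t x, 0 <= h t x) ->
  \int[mu]_w \int[mu]_q h w q =
  \int[mu]_t \int[mu]_x ((`|x| / (1 + t ^+ 2))%:E *
     h (x / Num.sqrt (1 + t ^+ 2))%R (`|x| * t / Num.sqrt (1 + t ^+ 2))%R).
Proof.
move=> mh h0.
have mh1 : measurable_fun setT
    (fun v : M * M => (`|v.1|)%:E * h v.1 (`|v.1| * v.2)%R).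
  apply: emeasurable_funM.
    by apply/measurable_EFinP; measurability.
  by apply: (measurable_comp2 fst (fun v : M * M => (`|v.1| * v.2)%R) mh);
    measurability.
have h10 w t : 0 <= (`|w|)%:E * h w (`|w| * t)%R.
  by rewrite mule_ge0 ?lee_fin.
rewrite (eq_integral_off0 _
  (fun w => \int[mu]_t ((`|w|)%:E * h w (`|w| * t)%R))).
(* At fixed [t] the rescaling contributes [1 / s], and [|w| = |x| / s]; together they give
   [|x| / s^2]. *)
- rewrite (swap_integral mh1 h10); apply: eq_integral => t _.
  set s := Num.sqrt (1 + t ^+ 2).
  have s0 : (0 < s)%R by rewrite sqrtr_gt0 ltr_pwDl// sqr_ge0.
  have s2 : (s ^+ 2 = 1 + t ^+ 2)%R.
    by rewrite sqr_sqrtr// addr_ge0// sqr_ge0.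
  rewrite (ge0_integral_affine s^-1 0%R); last 3 first.
  + by rewrite invr_gt0.
  + exact: (measurableT_comp mh1 (pair2_measurable t)).
  + by move=> x; exact: h10.
  rewrite -ge0_integralZl//; last 2 first.
  + apply: (measurableT_comp (measurableT_comp mh1 (pair2_measurable t))).
    exact: measurable_affine.
  + by rewrite lee_fin invr_ge0 ltW.
  apply: eq_integral => x _.
  rewrite addr0 muleA -EFinM normrM (gtr0_norm (x := s^-1)) ?invr_gt0// -s2.
  congr (_%:E * h _ _); try (by field; rewrite gt_eqF). 
- exact: measurable_integral.
- exact: measurable_integral.
(* What remains is the inner substitution [q = |w| t], legitimate since [|w| > 0]. *)
move=> w w0.
rewrite (ge0_integral_affine `|w|%R 0%R) ?normr_gt0//; last first.
  by apply: (measurableT_comp mh (pair1_measurable w)).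
rewrite -ge0_integralZl//.
- by apply: eq_integral => t _; rewrite addr0.
- apply: (measurableT_comp (measurableT_comp mh (pair1_measurable w))).
  exact: measurable_affine.
Qed.

End Plane.

(** * Reordering and slope substitution in fourfold integrals *)

Section FourFold.
Context {K : realType}.
Notation mu := (@lebesgue_measure K).
Notation M := (measurableTypeR K).
Local Open Scope ereal_scope.

Definition measurable4 (f : M -> M -> M -> M -> \bar K) :=
  measurable_fun setT (fun v : (M * M) * (M * M) => f v.1.1 v.1.2 v.2.1 v.2.2).

Lemma measurable_comp4 {f : M -> M -> M -> M -> \bar K} {d}
    {T : measurableType d} (f1 f2 f3 f4 : T -> K) :
  measurable4 f -> measurable_fun setT f1 -> measurable_fun setT f2 ->
  measurable_fun setT f3 -> measurable_fun setT f4 ->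
  measurable_fun setT (fun t => f (f1 t) (f2 t) (f3 t) (f4 t)).
Proof.
move=> mf m1 m2 m3 m4.
exact: (measurableT_comp mf
  (measurable_fun_pair (T1 := (M * M)%type) (T2 := (M * M)%type)
    (measurable_fun_pair (T1 := M) (T2 := M) m1 m2)
    (measurable_fun_pair (T1 := M) (T2 := M) m3 m4))).
Qed.

(** The variables to exchange are separated by [x]. Moving [x] outermost on both sides makes them
    adjacent, and one further exchange finishes. This carries the symmetry between the two
    slopes. *)
Lemma swap_outer_middle (f : M -> M -> M -> M -> \bar K) :
  measurable4 f -> (forall a b c e, 0 <= f a b c e) ->
  \int[mu]_t \int[mu]_x \int[mu]_v \int[mu]_y f t x v y =
  \int[mu]_t \int[mu]_x \int[mu]_v \int[mu]_y f v x t y.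
Proof.
move=> mf f0.
have m3 d (T : measurableType d) (f1 f2 f3 : T -> K) :
    measurable_fun setT f1 -> measurable_fun setT f2 ->
    measurable_fun setT f3 ->
    measurable_fun setT (fun t => \int[mu]_y f (f1 t) (f2 t) (f3 t) y).
  move=> m1 m2 m3; apply: measurable_integral => //.
  by apply: (measurable_comp4 (T := (T * M)%type) (fun v => f1 v.1)
    (fun v => f2 v.1) (fun v => f3 v.1) snd mf); measurability.
have i0 a b c : 0 <= \int[mu]_y f a b c y by exact: integral_ge0.
have m2 : measurable_fun setT
    (fun v : M * M => \int[mu]_z \int[mu]_y f v.1 v.2 z y).
  apply: measurable_integral => //.
  by apply: (m3 _ (M * M * M)%type (fun v => v.1.1) (fun v => v.1.2) snd);
    measurability.
have m2' : measurable_fun setT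
    (fun v : M * M => \int[mu]_z \int[mu]_y f z v.2 v.1 y).
  apply: measurable_integral => //.
  by apply: (m3 _ (M * M * M)%type snd (fun v => v.1.2) (fun v => v.1.1));
    measurability.
have i00 a b : 0 <= \int[mu]_z \int[mu]_y f a b z y by exact: integral_ge0.
have i00' a b : 0 <= \int[mu]_z \int[mu]_y f z b a y by exact: integral_ge0.
have E1 := @swap_integral _ (fun t x => \int[mu]_v \int[mu]_y f t x v y) m2 i00.
have E2 := @swap_integral _
  (fun t x => \int[mu]_v \int[mu]_y f v x t y) m2' i00'.
apply: (etrans E1); apply/esym; apply: (etrans E2); apply: eq_integral => x _.
apply/esym.
apply: (@swap_integral _ (fun t v => \int[mu]_y f t x v y)) _ (i0 ^~ x).
by apply: (m3 _ (M * M)%type fst (cst x) snd); measurability.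
Qed.

(** The planar substitution is applied to [(w, q)], giving slope [t], and then to [(z, p)] inside,
    giving slope [v]. *)
Lemma slope_substitution4 (f : M -> M -> M -> M -> \bar K) :
  measurable4 f -> (forall a b c e, 0 <= f a b c e) ->
  \int[mu]_w \int[mu]_z \int[mu]_p \int[mu]_q f w z p q =
  \int[mu]_t \int[mu]_x \int[mu]_v \int[mu]_y
    ((`|x| / (1 + t ^+ 2) * (`|y| / (1 + v ^+ 2)))%:E *
     f (x / Num.sqrt (1 + t ^+ 2))%R (y / Num.sqrt (1 + v ^+ 2))%R
       (`|y| * v / Num.sqrt (1 + v ^+ 2))%R
       (`|x| * t / Num.sqrt (1 + t ^+ 2))%R).
Proof.
move=> mf f0.
have mp d (T : measurableType d) (f1 f2 f3 : T -> K) :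
    measurable_fun setT f1 -> measurable_fun setT f2 ->
    measurable_fun setT f3 ->
    measurable_fun setT (fun t => \int[mu]_p f (f1 t) (f2 t) p (f3 t)).
  move=> m1 m2 m3; apply: measurable_integral => //.
  by apply: (measurable_comp4 (T := (T * M)%type) (fun v => f1 v.1)
    (fun v => f2 v.1) snd (fun v => f3 v.1) mf); measurability.
have i0 a b c : 0 <= \int[mu]_p f a b p c by exact: integral_ge0.
(* The integral over [q] is moved outwards past [p] and [z], next to its partner [w]. *)
transitivity (\int[mu]_w \int[mu]_q \int[mu]_z \int[mu]_p f w z p q).
  apply: eq_integral => w _.
  transitivity (\int[mu]_z \int[mu]_q \int[mu]_p f w z p q).
    apply: eq_integral => z _.
    rewrite (@swap_integral _ (fun p q => f w z p q))//.
    by apply: (measurable_comp4 (T := (M * M)%type) (cst w) (cst z) fst snd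
      mf); measurability.
  apply: (@swap_integral _ (fun z q => \int[mu]_p f w z p q)) _ (i0 w).
  by apply: (mp _ (M * M)%type (cst w) fst snd); measurability.
have mzp : measurable_fun setT
    (fun v : M * M => \int[mu]_z \int[mu]_p f v.1 z p v.2).
  apply: measurable_integral => [|v z]; last exact: i0.
  by apply: (mp _ (M * M * M)%type (fun v => v.1.1) snd (fun v => v.1.2));
    measurability.
apply: (etrans (@slope_substitution _
  (fun w q => \int[mu]_z \int[mu]_p f w z p q) mzp _)).
  by move=> w q; apply: integral_ge0 => z _; exact: i0.
apply: eq_integral => t _; apply: eq_integral => x _.
have c0 : (0 <= `|x| / (1 + t ^+ 2))%R.
  by rewrite divr_ge0// addr_ge0// sqr_ge0.
set w := (x / _)%R; set q := (_ * t / _)%R.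
have mzp' : measurable_fun setT (fun v : M * M => f w v.1 v.2 q).
  by apply: (measurable_comp4 (T := (M * M)%type) (cst w) fst snd (cst q) mf);
    measurability.
rewrite (@slope_substitution _ (fun z p => f w z p q) mzp'
  (fun z p => f0 w z p q)).
(* [g] is the integrand after the second substitution; the rest moves the Jacobian factor of the
   first one inside the integrals over [v] and [y]. *)
pose g v y := (`|y| / (1 + v ^+ 2))%:E *
  f w (y / Num.sqrt (1 + v ^+ 2))%R (`|y| * v / Num.sqrt (1 + v ^+ 2))%R q.
have mg d (T : measurableType d) (f1 f2 : T -> K) :
    measurable_fun setT f1 -> measurable_fun setT f2 ->
    measurable_fun setT (fun t => g (f1 t) (f2 t)).
  move=> m1 m2; apply: emeasurable_funM.
    by apply/measurable_EFinP; measurability.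
  apply: (measurable_comp4 (cst w) (fun t => f2 t / Num.sqrt (1 + f1 t ^+ 2))%R
   (fun t => `|f2 t| * f1 t / Num.sqrt (1 + f1 t ^+ 2))%R (cst q) mf);
  by measurability.
have g0 v y : 0 <= g v y.
  by rewrite mule_ge0// lee_fin divr_ge0// addr_ge0// sqr_ge0.
have mgy : measurable_fun setT (fun v : M => \int[mu]_y g v y).
  apply: measurable_integral => [|v y]; last exact: g0.
  by apply: (mg _ (M * M)%type fst snd); measurability.
rewrite -(@ge0_integralZl _ M K mu setT measurableT
  (fun v => \int[mu]_y g v y) mgy);
  last 2 first.
- by move=> v _; apply: integral_ge0 => y _; exact: g0.
- by rewrite lee_fin.
apply: eq_integral => v _.
rewrite -(@ge0_integralZl _ M K mu setT measurableT (g v)); last 3 first.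
- by apply: (mg _ M (cst v) id); measurability.
- by move=> y _; exact: g0.
- by rewrite lee_fin.
by apply: eq_integral => y _; rewrite EFinM muleA.
Qed.

End FourFold.

(** * Expectations of independent variables with densities *)

Section JointDensity.
Context {d} {T : measurableType d} {K : realType} (P : probability T K).
Notation mu := (@lebesgue_measure K).
Notation M := (measurableTypeR K).
Local Open Scope ereal_scope.

Lemma integral_product_density (m1 m2 : probability M K) (g1 g2 : M -> K)
    (f : M * M -> \bar K) :
  measurable_fun [set: M] g1 -> (forall x, 0 <= g1 x)%R ->
  measurable_fun [set: M] g2 -> (forall x, 0 <= g2 x)%R ->
  (forall A, measurable A -> m1 A = \int[mu]_(x in A) (g1 x)%:E) ->
  (forall A, measurable A -> m2 A = \int[mu]_(x in A) (g2 x)%:E) ->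
  measurable_fun setT f -> (forall v, 0 <= f v) ->
  \int[m1 \x m2]_v f v =
  \int[mu]_x \int[mu]_y ((g1 x * g2 y)%:E * f (x, y)).
Proof.
move=> mg1 g10 mg2 g20 m1E m2E mf f0.
rewrite (fubini_tonelli1 (m1 := m1) (m2 := m2) f mf f0).
rewrite (ge0_integral_density mu m1 g1 (fubini_F m2 f) mg1 g10 m1E);
  last 2 first.
- exact: measurable_fun_fubini_tonelli_F.
- by move=> x; exact: integral_ge0.
apply: eq_integral => x _; rewrite /fubini_F.
have mfx : measurable_fun setT (fun y : M => f (x, y)).
  exact: (measurableT_comp mf (pair1_measurable x)).
rewrite (ge0_integral_density mu m2 g2 (fun y => f (x, y)) mg2 g20 m2E mfx);
  last first.
  by move=> y; exact: f0.
rewrite -(@ge0_integralZl _ M K mu setT measurableT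
  (fun y => (g2 y)%:E * f (x, y))); last 3 first.
- by apply: emeasurable_funM => //; exact/measurable_EFinP.
- by move=> y _; rewrite mule_ge0// lee_fin.
- by rewrite lee_fin.
by apply: eq_integral => y _; rewrite muleA EFinM.
Qed.

(** The law of the four variables, seen as a pair of pairs, is a product of two product measures;
    integrating each pair against its densities yields the iterated integral. *)
Lemma integral_joint_density (X1 X2 X3 X4 : {RV P >-> M}) (g1 g2 g3 g4 : M -> K)
    (f : M -> M -> M -> M -> \bar K) :
  (forall A B C D : set M,
    measurable A -> measurable B -> measurable C -> measurable D ->
    P ((X1 @^-1` A `&` X2 @^-1` B) `&` (X3 @^-1` C `&` X4 @^-1` D)) =
    (P (X1 @^-1` A) * P (X2 @^-1` B)) * (P (X3 @^-1` C) * P (X4 @^-1` D))) ->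
  measurable_fun [set: M] g1 -> (forall x, 0 <= g1 x)%R ->
  measurable_fun [set: M] g2 -> (forall x, 0 <= g2 x)%R ->
  measurable_fun [set: M] g3 -> (forall x, 0 <= g3 x)%R ->
  measurable_fun [set: M] g4 -> (forall x, 0 <= g4 x)%R ->
  has_law X1 (fun A => \int[mu]_(x in A) (g1 x)%:E) ->
  has_law X2 (fun A => \int[mu]_(x in A) (g2 x)%:E) ->
  has_law X3 (fun A => \int[mu]_(x in A) (g3 x)%:E) ->
  has_law X4 (fun A => \int[mu]_(x in A) (g4 x)%:E) ->
  measurable4 f -> (forall a b c e, 0 <= f a b c e) ->
  \int[P]_t f (X1 t) (X2 t) (X3 t) (X4 t) =
  \int[mu]_w \int[mu]_z \int[mu]_r \int[mu]_u
    ((g1 w * g2 z * (g3 r * g4 u))%:E * f w z r u).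
Proof.
move=> ind mg1 g10 mg2 g20 mg3 g30 mg4 g40 l1 l2 l3 l4 mf f0.
pose m1 : probability M K := distribution P X1.
pose m2 : probability M K := distribution P X2.
pose m3 : probability M K := distribution P X3.
pose m4 : probability M K := distribution P X4.
have mX1 : measurable_fun setT X1 by exact: measurable_funP.
have mX2 : measurable_fun setT X2 by exact: measurable_funP.
have mX3 : measurable_fun setT X3 by exact: measurable_funP.
have mX4 : measurable_fun setT X4 by exact: measurable_funP.
have mX12 : measurable_fun setT (fun t => (X1 t, X2 t)).
  exact: measurable_fun_pair.
have mX34 : measurable_fun setT (fun t => (X3 t, X4 t)).
  exact: measurable_fun_pair.
have pre (X : {RV P >-> M}) A : measurable A -> measurable (X @^-1` A).
  by move=> mA; exact: measurable_funPTI.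
(* First use of [joint_law]: rectangles in [(X3, X4)] are upgraded to arbitrary measurable sets,
   with an event on [(X1, X2)] held fixed. *)
have ind34 A B C : measurable A -> measurable B -> measurable C ->
    P ((X1 @^-1` A `&` X2 @^-1` B) `&` (fun t => (X3 t, X4 t)) @^-1` C) =
    P (X1 @^-1` A `&` X2 @^-1` B) * (m3 \x m4) C.
  move=> mA mB mC.
  apply: (joint_law P m3 m4 (X1 @^-1` A `&` X2 @^-1` B) X3 X4) => //.
    by apply: measurableI; exact: pre.
  move=> A' B' mA' mB'; rewrite ind//; congr (_ * _).
  have := ind _ _ _ _ mA mB measurableT measurableT.
  by rewrite !preimage_setT !setIT probability_setT !mule1 => ->.
(* Second use, with the roles reversed: the fixed event is now an arbitrary one on [(X3, X4)]. *)
have ind12 C D : measurable C -> measurable D ->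
    P ((fun t => (X3 t, X4 t)) @^-1` D `&` (fun t => (X1 t, X2 t)) @^-1` C) =
    P ((fun t => (X3 t, X4 t)) @^-1` D) * (m1 \x m2) C.
  move=> mC mD.
  apply: (joint_law P m1 m2 _ X1 X2) => //.
    by rewrite -[X in measurable X]setTI; exact: mX34.
  move=> A B mA mB; rewrite setIC ind34//.
  have := ind34 _ _ _ measurableT measurableT mD.
  rewrite !preimage_setT !setTI probability_setT mul1e => ->.
  rewrite muleC; congr (_ * _).
  have := ind _ _ _ _ mA mB measurableT measurableT.
  by rewrite !preimage_setT !setIT probability_setT !mule1 => ->.
have P34 D : measurable D -> P ((fun t => (X3 t, X4 t)) @^-1` D) = (m3 \x m4) D.
  move=> mD.
  have := ind34 _ _ _ measurableT measurableT mD.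
  by rewrite !preimage_setT !setTI probability_setT mul1e.
pose V t := ((X1 t, X2 t), (X3 t, X4 t)).
have mV : measurable_fun setT V by exact: measurable_fun_pair.
have [l lE] : exists l : {measure set ((M * M) * (M * M)) -> \bar K},
    l = pushforward P V :> (set _ -> \bar K).
  by unshelve eexists; first exact: (pushforward P V).
pose F (v : (M * M) * (M * M)) := f v.1.1 v.1.2 v.2.1 v.2.2.
have F0 v : 0 <= F v by exact: f0.
pose q12 : probability (M * M)%type K := (m1 \x m2)%E.
pose q34 : probability (M * M)%type K := (m3 \x m4)%E.
have lq D : measurable D -> (q12 \x q34)%E D = l D.
  apply: (@product_measure_unique _ _ _ _ K q12 q34 l) => A B mA mB.
  transitivity (P (V @^-1` (A `*` B))); first by rewrite lE.
  have -> : V @^-1` (A `*` B) =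
      (fun t => (X3 t, X4 t)) @^-1` B `&` (fun t => (X1 t, X2 t)) @^-1` A.
    by rewrite setIC.
  by rewrite ind12// P34// muleC.
transitivity (\int[l]_v F v).
  by rewrite lE ge0_integral_pushforward.
rewrite (eq_measure_integral (q12 \x q34)%E); last first.
  by move=> D mD _; apply/esym; exact: lq.
apply: (etrans (@fubini_tonelli1 _ _ _ _ K q12 q34 F mf F0)).
apply: (etrans (integral_product_density m1 m2 g1 g2 (fubini_F q34 F)
  mg1 g10 mg2 g20 l1 l2 _ _)).
- exact: measurable_fun_fubini_tonelli_F.
- by move=> x; exact: integral_ge0.
apply: eq_integral => w _; apply: eq_integral => z _; rewrite /fubini_F.
have mFwz : measurable_fun setT (fun b => F ((w, z), b)).
  exact: (measurableT_comp mf (pair1_measurable (w, z))).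
rewrite (integral_product_density m3 m4 g3 g4 _ mg3 g30 mg4 g40 l3 l4 mFwz);
  last first.
  by move=> x; exact: F0.
pose h r u := ((g3 r * g4 u)%:E * F (w, z, (r, u))).
have h0 r u : 0 <= h r u by rewrite mule_ge0// lee_fin mulr_ge0.
have mh d' (T' : measurableType d') (f1 f2 : T' -> M) :
    measurable_fun setT f1 -> measurable_fun setT f2 ->
    measurable_fun setT (fun t => h (f1 t) (f2 t)).
  move=> mf1 mf2; apply: emeasurable_funM.
    by apply/measurable_EFinP; apply: measurable_funM; exact: measurableT_comp.
  exact: (measurableT_comp mFwz (measurable_fun_pair mf1 mf2)).
rewrite -(@ge0_integralZl _ M K mu setT measurableT
  (fun r => \int[mu]_u h r u)); last 3 first.
- apply: measurable_integral => [|r u]; last exact: h0.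
  exact: (mh _ (M * M)%type fst snd).
- by move=> r _; apply: integral_ge0 => u _; exact: h0.
- by rewrite lee_fin mulr_ge0.
apply: eq_integral => r _.
rewrite -(@ge0_integralZl _ M K mu setT measurableT (h r)); last 3 first.
- exact: (mh _ M (cst r) id).
- by move=> u _; exact: h0.
- by rewrite lee_fin mulr_ge0.
by apply: eq_integral => u _; rewrite muleA -EFinM.
Qed.

End JointDensity.

(** * Splitting a Rayleigh variable by an independent uniform one *)

Section RayleighSplit.
Context {K : realType}.
Notation mu := (@lebesgue_measure K).
Notation M := (measurableTypeR K).
Local Open Scope ereal_scope.

Lemma rayleigh_pdf_ge0 (r : K) : (0 <= rayleigh_pdf r)%R.
Proof.
by rewrite /rayleigh_pdf; case: ifP => // r0; rewrite mulr_ge0 ?expR_ge0// ltW.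
Qed.

Lemma measurable_rayleigh_pdf : measurable_fun [set: M] (@rayleigh_pdf K).
Proof.
apply: measurable_fun_ifT; last exact: measurable_cst.
  exact: measurable_fun_ltr.
by measurability.
Qed.

Lemma uniform01_pdfE (u : K) :
  uniform_pdf 0 1 u = ((0 <= u)%R%:R * (u <= 1)%R%:R)%R.
Proof. rewrite /uniform_pdf subr0 invr1.
by case: (0 <= u)%R; case: (u <= 1)%R; rewrite /= ?mulr1 ?mulr0 ?mul0r. Qed.

(* The density of [(U R, (1 - U) R)]. *)
Definition split_density (p q : K) : K :=
  ((0 <= p)%R%:R * (0 <= q)%R%:R * expR (- (p + q) ^+ 2 / 2))%R.

(** At fixed [r > 0], the factor [r] of the Rayleigh density is exactly the Jacobian of [p = u r].
    Exchanging the integrals and translating by [r = p + q] then leaves only the exponential on the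
    quadrant. *)
Lemma rayleigh_split (h : M -> M -> \bar K) :
  measurable_fun setT (fun v : M * M => h v.1 v.2) ->
  (forall t x, 0 <= h t x) ->
  \int[mu]_r \int[mu]_u ((rayleigh_pdf r * uniform_pdf 0 1 u)%:E *
     h (u * r)%R ((1 - u) * r)%R) =
  \int[mu]_p \int[mu]_q ((split_density p q)%:E * h p q).
Proof.
move=> mh h0.
(* The intermediate integrand in [(r, p)]: the uniform constraint on [u] becomes [0 <= p <= r]. *)
pose g r p :=
  ((0 <= p)%R%:R * (p <= r)%R%:R * expR (- r ^+ 2 / 2))%:E * h p (r - p)%R.
have g0 r p : 0 <= g r p by rewrite mule_ge0// lee_fin !mulr_ge0// expR_ge0.
have mg d (T : measurableType d) (f1 f2 : T -> K) :
    measurable_fun setT f1 -> measurable_fun setT f2 ->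
    measurable_fun setT (fun t => g (f1 t) (f2 t)).
  move=> mf1 mf2; apply: emeasurable_funM.
    by apply/measurable_EFinP; measurability.
  by apply: (measurable_comp2 f2 (fun t => f1 t - f2 t)%R mh); measurability.
have mg2 : measurable_fun setT (fun v : M * M => g v.1 v.2).
  by apply: (mg _ (M * M)%type fst snd); measurability.
transitivity (\int[mu]_r \int[mu]_p g r p).
  apply: eq_integral_off0.
  - apply: measurable_integral => [|r u]; last first.
      rewrite mule_ge0// lee_fin mulr_ge0 ?rayleigh_pdf_ge0//.
      by rewrite uniform01_pdfE mulr_ge0.
    apply: emeasurable_funM.
      apply/measurable_EFinP; apply: measurable_funM.
        exact: (measurableT_comp measurable_rayleigh_pdf measurable_fst).
      exact: (measurableT_comp (measurable_uniform_pdf _ _) measurable_snd).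
    by apply: (measurable_comp2 (T := (M * M)%type)
      (fun v => v.2 * v.1)%R (fun v => (1 - v.2) * v.1)%R mh); measurability.
  - by apply: measurable_integral => [|r p]; [exact: mg2 | exact: g0].
  move=> r r_neq0.
  (* For [r < 0] both integrands vanish: the Rayleigh density is 0, and no [p] satisfies
     [0 <= p <= r]. *)
  have [r_lt0|r_gt0|r_eq0] := ltgtP r 0%R; last by rewrite r_eq0 eqxx in r_neq0.
    transitivity (\int[mu]_(u in [set: M]) (0 : \bar K)).
      apply: eq_integral => u _.
      by rewrite /rayleigh_pdf ltNge (ltW r_lt0) mul0r mul0e.
    apply: eq_integral => p _; rewrite /g.
    case: leP => p0; case: leP => pr; rewrite ?mul0r ?mulr0 ?mul0r ?mul0e//.
    by have := le_lt_trans (le_trans p0 pr) r_lt0; rewrite ltxx.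
  rewrite (@ge0_integral_affine K r 0%R (g r) r_gt0 _ (g0 r)); last first.
    by apply: (mg _ M (cst r) id); measurability.
  have mgr : measurable_fun setT (fun u : M => g r (r * u + 0)%R).
    by apply: (mg _ M (cst r) (fun u => r * u + 0)%R); measurability.
  rewrite -(@ge0_integralZl _ M K mu setT measurableT _ mgr); last 2 first.
  - by move=> u _; exact: g0.
  - by rewrite lee_fin ltW.
  apply: eq_integral => u _.
  rewrite /g addr0 muleA -EFinM uniform01_pdfE /rayleigh_pdf r_gt0.
  rewrite pmulr_rge0// ger_pMr//.
  congr (_%:E * h _ _); ring.
apply: (etrans (@swap_integral _ g mg2 g0)).
apply: eq_integral => p _.
rewrite (@ge0_integral_affine K 1%R p (fun r => g r p) ltr01 _ (g0 ^~ p));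
  last first.
  by apply: (mg _ M id (cst p)); measurability.
rewrite mul1e; apply: eq_integral => q _.
rewrite /g /split_density mul1r; congr (_%:E * h _ _); last by ring.
by rewrite lerDr [(q + p)%R]addrC.
Qed.

End RayleighSplit.

(** * The joint density in slope coordinates *)

Section Symmetry.
Context {K : realType}.
Notation mu := (@lebesgue_measure K).
Notation M := (measurableTypeR K).
Local Open Scope ereal_scope.

(* The density of [(W, Z, U R, (1 - U) R)]. *)
Definition joint_density (w z p q : K) : K :=
  (normal_pdf 0 1 w * normal_pdf 0 1 z * split_density p q)%R.

Lemma normal01_pdfE (x : K) :
  normal_pdf 0 1 x = (normal_peak 1 * expR (- x ^+ 2 / 2))%R.
Proof.
by rewrite normal_pdfE ?oner_neq0// /normal_fun subr0 expr1n.
Qed.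

(** Expanding [w^2 + z^2 + (p + q)^2], the squares recombine to [x^2 + y^2] because [a^2 = 1 + t^2]
    and [b^2 = 1 + v^2]; only a cross term symmetric in the slopes remains. The factor [|x| |y|] is
    kept on both sides because at [x = 0] or [y = 0] the signs of [p] and [q] no longer determine
    those of the slopes. *)
Lemma joint_density_slope (t x v y : K) (a := Num.sqrt (1 + t ^+ 2)%R)
   (b := Num.sqrt (1 + v ^+ 2)%R) :
  (`|x| * `|y| * joint_density (x / a) (y / b) (`|y| * v / b) (`|x| * t / a) =
  `|x| * `|y| * (normal_peak 1 ^+ 2 * ((0 <= v)%R%:R * (0 <= t)%R%:R) *
    expR (- (x ^+ 2 + y ^+ 2 + 2 * `|x * y| * (t * v) / (a * b)) / 2)))%R.
Proof.
have pos s : (0 < 1 + s ^+ 2 :> K)%R by rewrite ltr_pwDl// sqr_ge0.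
have [->|x0] := eqVneq x 0%R; first by rewrite normr0 !mul0r.
have [->|y0] := eqVneq y 0%R; first by rewrite normr0 mulr0 !mul0r.
have a0 : (0 < a)%R by rewrite sqrtr_gt0.
have b0 : (0 < b)%R by rewrite sqrtr_gt0.
have a2 : (a ^+ 2 = 1 + t ^+ 2)%R by rewrite sqr_sqrtr// ltW.
have b2 : (b ^+ 2 = 1 + v ^+ 2)%R by rewrite sqr_sqrtr// ltW.
congr (_ * _)%R.
rewrite /joint_density /split_density !normal01_pdfE.
have sgn (c s e : K) : (c != 0 -> 0 < e -> (0 <= `|c| * s / e) = (0 <= s))%R.
  by move=> c0 e0; rewrite pmulr_lge0 ?invr_gt0// pmulr_rge0 ?normr_gt0.
rewrite !sgn//.
have -> : (expR (- (x ^+ 2 + y ^+ 2 + 2 * `|x * y| * (t * v) / (a * b)) / 2) =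
   expR (- (x / a) ^+ 2 / 2) * expR (- (y / b) ^+ 2 / 2) *
   expR (- (`|y| * v / b + `|x| * t / a) ^+ 2 / 2) :> K)%R.
  rewrite -!expRD; congr expR; rewrite normrM.
  have -> : ((`|y| * v / b + `|x| * t / a) ^+ 2 =
     y ^+ 2 * v ^+ 2 / b ^+ 2 + x ^+ 2 * t ^+ 2 / a ^+ 2 +
     2 * `|x| * `|y| * (t * v) / (a * b) :> K)%R.
    rewrite -[(x ^+ 2)%R]real_normK ?num_real//.
    rewrite -[(y ^+ 2)%R]real_normK ?num_real//.
    by field; rewrite !gt_eqF.
  rewrite !expr_div_n a2 b2.
  by field; rewrite !gt_eqF.
by ring.
Qed.

End Symmetry.

(** * Application to the four random variables *)

Section FourVariables.
Context {K : realType} {d} {T : measurableType d} (P : probability T K).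
Notation mu := (@lebesgue_measure K).
Notation M := (measurableTypeR K).
Local Open Scope ereal_scope.

Lemma mutually_independent4 (X1 X2 X3 X4 : {RV P >-> K}) :
  mutually_independent (fun i : 'I_4 => tnth [tuple X1; X2; X3; X4] i) ->
  forall A1 A2 A3 A4 : set K,
    measurable A1 -> measurable A2 -> measurable A3 -> measurable A4 ->
    P ((X1 @^-1` A1 `&` X2 @^-1` A2) `&` (X3 @^-1` A3 `&` X4 @^-1` A4)) =
    (P (X1 @^-1` A1) * P (X2 @^-1` A2)) * (P (X3 @^-1` A3) * P (X4 @^-1` A4)).
Proof.
move=> indep A1 A2 A3 A4 m1 m2 m3 m4.
(* The full index set is enough: the fourfold product formula is its instance. *)
pose J := seq_fset tt (enum 'I_4).
have inJ i : i \in J by rewrite seq_fsetE mem_enum.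
pose A := tnth [tuple A1; A2; A3; A4].
have /(_ J A) := indep.
have mA i : i \in J -> measurable (A i).
  by case: i => -[|[|[|[|//]]]] /= ? _.
move=> /(_ mA).
have -> : \bigcap_(i in [set` J]) tnth [tuple X1; X2; X3; X4] i @^-1` A i =
    (X1 @^-1` A1 `&` X2 @^-1` A2) `&` (X3 @^-1` A3 `&` X4 @^-1` A4).
  apply/seteqP; split => [t At | t [[t1 t2] [t3 t4]]].
    by split; split;
      [ exact: (At (@Ordinal 4 0 isT) (inJ _))
      | exact: (At (@Ordinal 4 1 isT) (inJ _))
      | exact: (At (@Ordinal 4 2 isT) (inJ _))
      | exact: (At (@Ordinal 4 3 isT) (inJ _))].
  by case=> -[|[|[|[|//]]]] /= ? _.
move=> ->.
rewrite (perm_big (enum 'I_4)); last first.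
  by rewrite uniq_perm ?fset_uniq ?enum_uniq// => i; rewrite inJ mem_enum.
have E (a b c e : \bar K) : a * (b * (c * (e * 1))) = a * b * (c * e).
  by rewrite mule1 muleA.
by rewrite big_enum !big_ord_recl big_ord0; exact: E.
Qed.

Lemma measurable_lebesgue_rv (X : {RV P >-> K}) :
  measurable_fun [set: T] (X : T -> M).
Proof. exact: (@measurable_funPT _ _ _ _ X). Qed.

(** The same function, retyped so that its codomain is the measurable space that carries Lebesgue
    measure. *)
Definition lebesgue_rv (X : {RV P >-> K}) : {RV P >-> M} :=
  HB.pack (X : T -> M)
    (isMeasurableFun.Build _ _ T M _ (measurable_lebesgue_rv X)).

(** The joint density gives an integral over [(w, z, r, u)]; at fixed [w] and [z] the normal
    densities are a constant absorbed into the integrand, and [rayleigh_split] handles [(r, u)]. *)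
Lemma integral_split_law (W Z U R : {RV P >-> M})
    (k : M -> M -> M -> M -> \bar K) :
  (forall A B C D : set M,
    measurable A -> measurable B -> measurable C -> measurable D ->
    P ((W @^-1` A `&` Z @^-1` B) `&` (R @^-1` C `&` U @^-1` D)) =
    (P (W @^-1` A) * P (Z @^-1` B)) * (P (R @^-1` C) * P (U @^-1` D))) ->
  has_law W (normal_prob 0 1) -> has_law Z (normal_prob 0 1) ->
  has_law U (uniform_prob (@ltr01 K)) -> has_law R (@rayleigh_prob K) ->
  measurable4 k -> (forall a b c e, 0 <= k a b c e) ->
  \int[P]_t k (W t) (Z t) (U t * R t)%R ((1 - U t) * R t)%R =
  \int[mu]_w \int[mu]_z \int[mu]_p \int[mu]_q
    ((joint_density w z p q)%:E * k w z p q).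
Proof.
move=> indep lW lZ lU lR mk k0.
pose f w z r u := k w z (u * r)%R ((1 - u) * r)%R.
have mf : measurable4 f.
  by apply: (measurable_comp4 (T := (M * M * (M * M))%type) (fun v => v.1.1)
    (fun v => v.1.2) (fun v => v.2.2 * v.2.1)%R
    (fun v => (1 - v.2.2) * v.2.1)%R mk); measurability.
have f0 a b c e : 0 <= f a b c e by exact: k0.
apply: (etrans (integral_joint_density P W Z R U (normal_pdf 0 1)
  (normal_pdf 0 1) (@rayleigh_pdf K) (uniform_pdf 0 1) f indep _ _ _ _ _ _ _ _
  lW lZ lR lU mf f0)).
- exact: measurable_normal_pdf.
- by move=> x; exact: normal_pdf_ge0.
- exact: measurable_normal_pdf.
- by move=> x; exact: normal_pdf_ge0.
- exact: measurable_rayleigh_pdf.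
- by move=> x; exact: rayleigh_pdf_ge0.
- exact: measurable_uniform_pdf.
- by move=> x; exact: uniform_pdf_ge0.
apply: eq_integral => w _; apply: eq_integral => z _.
set c : K := (normal_pdf 0 1 w * normal_pdf 0 1 z)%R.
have c0 : (0 <= c)%R by rewrite mulr_ge0 ?normal_pdf_ge0.
pose h p q := c%:E * k w z p q.
have mh : measurable_fun setT (fun v : M * M => h v.1 v.2).
  apply: emeasurable_funM; first exact: measurable_cst.
  by apply: (measurable_comp4 (T := (M * M)%type) (cst w) (cst z) fst snd mk);
    measurability.
have h0 p q : 0 <= h p q by rewrite mule_ge0.
transitivity (\int[mu]_r \int[mu]_u ((rayleigh_pdf r * uniform_pdf 0 1 u)%:E *
     h (u * r)%R ((1 - u) * r)%R)).
  apply: eq_integral => r _; apply: eq_integral => u _.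
  by rewrite /h muleA -EFinM [(_ * c)%R]mulrC.
apply: (etrans (rayleigh_split h mh h0)).
apply: eq_integral => p _; apply: eq_integral => q _.
by rewrite /h muleA -EFinM [(_ * c)%R]mulrC.
Qed.

(** In slope coordinates the arguments of the indicators are [x^2 / (1 + v^2)] and
    [x^2 / (1 + t^2)], while density and Jacobian are symmetric in [t] and [v]. Only the slopes are
    exchanged; [x] and [y] stay in place. *)
Lemma integral_slope_symmetry (A : set K) : measurable A ->
  \int[mu]_w \int[mu]_z \int[mu]_p \int[mu]_q ((joint_density w z p q)%:E *
    (\1_A ((w ^+ 2 + q ^+ 2) / (1 + p ^+ 2 / z ^+ 2)))%:E) =
  \int[mu]_w \int[mu]_z \int[mu]_p \int[mu]_q ((joint_density w z p q)%:E *
    (\1_A (w ^+ 2))%:E).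
Proof.
move=> mA.
have m1A d' (T' : measurableType d') (f : T' -> K) : measurable_fun setT f ->
    measurable_fun setT (fun t => \1_A (f t) : K).
  by move=> mf; apply: (measurableT_comp _ mf); exact: measurable_indic.
have jd0 w z p q : (0 <= joint_density w z p q :> K)%R.
  by rewrite !mulr_ge0 ?normal_pdf_ge0 ?expR_ge0.
have mjd d' (T' : measurableType d') (f1 f2 f3 f4 : T' -> K) :
    measurable_fun setT f1 -> measurable_fun setT f2 ->
    measurable_fun setT f3 -> measurable_fun setT f4 ->
    measurable_fun setT (fun t => joint_density (f1 t) (f2 t) (f3 t) (f4 t)).
  move=> mf1 mf2 mf3 mf4; apply: measurable_funM; last first.
    by rewrite /split_density; measurability.
  by apply: measurable_funM;
    exact: (measurableT_comp (measurable_normal_pdf 0 1)).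
pose k1 (w z p q : M) := (joint_density w z p q)%:E *
  (\1_A ((w ^+ 2 + q ^+ 2) / (1 + p ^+ 2 / z ^+ 2)))%:E.
pose k2 (w z p q : M) := (joint_density w z p q)%:E * (\1_A (w ^+ 2))%:E.
have k10 w z p q : 0 <= k1 w z p q by rewrite mule_ge0 ?lee_fin.
have k20 w z p q : 0 <= k2 w z p q by rewrite mule_ge0 ?lee_fin.
have mk1 : measurable4 k1.
  apply: emeasurable_funM; apply/measurable_EFinP.
    by apply: (mjd _ (M * M * (M * M))%type); measurability.
  by apply: (m1A _ (M * M * (M * M))%type); measurability.
have mk2 : measurable4 k2.
  apply: emeasurable_funM; apply/measurable_EFinP.
    by apply: (mjd _ (M * M * (M * M))%type); measurability.
  by apply: (m1A _ (M * M * (M * M))%type); measurability.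
apply: (etrans (slope_substitution4 k1 mk1 k10)).
apply/esym; apply: (etrans (slope_substitution4 k2 mk2 k20)).
pose F t x v y := (`|x| / (1 + t ^+ 2) * (`|y| / (1 + v ^+ 2)))%:E *
     k2 (x / Num.sqrt (1 + t ^+ 2))%R (y / Num.sqrt (1 + v ^+ 2))%R
       (`|y| * v / Num.sqrt (1 + v ^+ 2))%R
       (`|x| * t / Num.sqrt (1 + t ^+ 2))%R.
have F0 t x v y : 0 <= F t x v y.
  by rewrite mule_ge0// lee_fin mulr_ge0// divr_ge0// addr_ge0// sqr_ge0.
have mF : measurable4 F.
  apply: emeasurable_funM.
    by apply/measurable_EFinP; measurability.
  by apply: (measurable_comp4 (T := (M * M * (M * M))%type)
    (fun v => v.1.2 / Num.sqrt (1 + v.1.1 ^+ 2))%R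
    (fun v => v.2.2 / Num.sqrt (1 + v.2.1 ^+ 2))%R
    (fun v => `|v.2.2| * v.2.1 / Num.sqrt (1 + v.2.1 ^+ 2))%R
    (fun v => `|v.1.2| * v.1.1 / Num.sqrt (1 + v.1.1 ^+ 2))%R mk2);
    measurability.
apply: (etrans (swap_outer_middle F mF F0)).
apply: eq_integral => t _; apply: eq_integral => x _.
apply: eq_integral => v _; apply: eq_integral => y _.
rewrite /F /k1 /k2 !muleA -!EFinM.
have pos s : (0 < 1 + s ^+ 2 :> K)%R by rewrite ltr_pwDl// sqr_ge0.
(* Brings [|x| |y|] next to the joint density, the shape that [joint_density_slope] rewrites. *)
have regroup a b c e j i :
    (a / b * (c / e) * j * i = a * c * j / (b * e) * i :> K)%R.
  by rewrite invfM; ring.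
congr EFin; rewrite [LHS]regroup [RHS]regroup !joint_density_slope.
have [->|x0] := eqVneq x 0%R; first by rewrite normr0 !mul0r.
have [->|y0] := eqVneq y 0%R; first by rewrite normr0 mulr0 !mul0r.
congr (_ * \1_A _)%R.
  rewrite [((1 + v ^+ 2) * _)%R]mulrC [((0 <= t)%R%:R * _)%R]mulrC.
  by rewrite [(v * t)%R]mulrC [(Num.sqrt (1 + v ^+ 2) * _)%R]mulrC.
have sq c s : ((c / Num.sqrt (1 + s ^+ 2)) ^+ 2 = c ^+ 2 / (1 + s ^+ 2) :> K)%R.
  by rewrite expr_div_n sqr_sqrtr// ltW.
have sqM c s : ((`|c| * s) ^+ 2 = c ^+ 2 * s ^+ 2 :> K)%R.
  by rewrite exprMn real_normK ?num_real.
(* Here [w^2 + q^2 = x^2] and, as [y] is nonzero, [p^2 / z^2 = v^2]. *)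
rewrite !sq !sqM.
by field; rewrite ?y0 ?gt_eqF.
Qed.

End FourVariables.

(** * From the integral identity back to equality in law *)

Theorem corollary7 (K : realType) (d : measure_display) (T : measurableType d)
    (P : probability T K) (W Z U R : {RV P >-> K})
    (lawW : has_law W (normal_prob (0 : K) (1 : K)))
    (lawZ : has_law Z (normal_prob (0 : K) (1 : K)))
    (lawU : has_law U (uniform_prob (@ltr01 K)))
    (lawR : has_law R (@rayleigh_prob K))
    (indep : mutually_independent (fun i : 'I_4 => tnth [tuple W; Z; U; R] i)) :
  eq_in_law (T' := K) P
    (fun t => (W t ^+ 2 + (1 - U t) ^+ 2 * R t ^+ 2)
              / (1 + U t ^+ 2 * R t ^+ 2 / Z t ^+ 2))
    (fun t => Z t ^+ 2).
Proof.
have mW : measurable_fun setT W by exact: measurable_funP.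
have mZ : measurable_fun setT Z by exact: measurable_funP.
have mU : measurable_fun setT U by exact: measurable_funP.
have mR : measurable_fun setT R by exact: measurable_funP.
set Y := fun t => _ / _.
have mY : measurable_fun setT Y by rewrite /Y; measurability.
split => //; first by measurability.
move=> A mA; rewrite /pushforward.
(* The slope symmetry produces [W^2], so the target [Z^2] is first replaced by it, the two having
   the same law. *)
have ZW : P ((fun t => Z t ^+ 2) @^-1` A) = P ((fun t => W t ^+ 2) @^-1` A).
  have mA2 : measurable ((fun x : K => x ^+ 2) @^-1` A).
    rewrite -[X in measurable X]setTI.
    have : measurable_fun setT (fun x : K => x ^+ 2) by measurability.
    by apply.
  by have := lawZ _ mA2; rewrite -(lawW _ mA2).
rewrite ZW.
have indep' B C D E : measurable B -> measurable C -> measurable D ->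
    measurable E ->
    (P ((W @^-1` B `&` Z @^-1` C) `&` (R @^-1` D `&` U @^-1` E)) =
    (P (W @^-1` B) * P (Z @^-1` C)) * (P (R @^-1` D) * P (U @^-1` E)))%E.
  move=> mB mC mD mE; rewrite [R @^-1` D `&` _]setIC.
  rewrite (mutually_independent4 P _ _ _ _ indep)//.
  by rewrite [(P (R @^-1` D) * _)%E]muleC.
pose M := measurableTypeR K.
(* Applied to both statistics, each a function of [(W, Z, U R, (1 - U) R)], by integrating the
   indicator of [A]. *)
have law_int (k : M -> M -> M -> M -> K) :
    measurable_fun setT
      (fun v : (M * M) * (M * M) => k v.1.1 v.1.2 v.2.1 v.2.2) ->
    P ((fun t => k (W t) (Z t) (U t * R t) ((1 - U t) * R t)) @^-1` A) =
    (\int[lebesgue_measure]_w \int[lebesgue_measure]_z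
      \int[lebesgue_measure]_p \int[lebesgue_measure]_q
      ((joint_density w z p q)%:E * (\1_A (k w z p q))%:E))%E.
  move=> mk.
  pose kt t := k (W t) (Z t) (U t * R t) ((1 - U t) * R t).
  have mkt : measurable_fun setT kt.
    apply/measurable_EFinP.
    apply: (measurable_comp4 W Z (fun t => U t * R t)
      (fun t => (1 - U t) * R t) (f := fun w z p q => (k w z p q)%:E)) => //;
      last 2 first; try by measurability.
    exact/measurable_EFinP.
  rewrite -(integral_split_law P (lebesgue_rv P W) (lebesgue_rv P Z)
    (lebesgue_rv P U) (lebesgue_rv P R)
    (fun w z p q => (\1_A (k w z p q))%:E) indep' lawW lawZ lawU lawR) /=.
  - transitivity (\int[P]_t (\1_(kt @^-1` A) t)%:E)%E => [|//].
    rewrite integral_indic// ?setIT//.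
    by rewrite -[X in measurable X]setTI; exact: mkt.
  - apply/measurable_EFinP; apply: (measurableT_comp _ mk).
    exact: measurable_indic.
  - by move=> *; rewrite lee_fin.
rewrite (law_int (fun w z p q => w ^+ 2)); last by measurability.
rewrite -(integral_slope_symmetry A mA).
rewrite -(law_int (fun w z p q => (w ^+ 2 + q ^+ 2) / (1 + p ^+ 2 / z ^+ 2))).
  by congr (P (_ @^-1` A)); apply/funext => t; rewrite /Y !exprMn.
by measurability.
Qed.
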